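(* Let $K$ be a bounded subset of $L_1(0,\infty)$ satisfying the condition $$\sup_{f\in K}\int_N^\infty \mu(s,f)\,ds\to 0,\qquad N\to\infty.$$ Then the following two conditions are equivalent: (i) there exists an Orlicz function $G$ with $\frac{G(t)}{t}\to\infty$ as $t\to\infty$ such that $$\sup\left\{\int_0^\infty G(|f(s)|)\,ds:\ f\in K\right\}<\infty;$$ (ii) there exists a positive function $g\in L_1(0,\infty)$ such that $|f|\prec\prec g$ for all $f\in K$.
   Context: The half-line $(0,\infty)$ is equipped with Lebesgue measure $m$; functions are real-valued and measurable, and ''bounded'' means bounded in the $L_1$-norm. Orlicz function: a function $G:[0,\infty)\to[0,\infty]$ such that $G(0)=0$, $G$ is not identically zero, $G$ is convex, and $G$ is continuous at zero. Decreasing rearrangement: for a measurable function $f$ on $(0,\infty)$ with $m(\{|f|>s\})<\infty$ for some $s>0$, $\mu(t,f)=\inf\{s\ge 0:\ m(\{|f|>s\})\le t\}$ for $t\ge 0$. Submajorization in the sense of Hardy–Littlewood–Pólya: $f\prec\prec g$ means $\int_0^t\mu(s,f)\,ds\le\int_0^t\mu(s,g)\,ds$ for all $t\ge 0$. *)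

(* Defs.v *)
From HB Require Import structures.
From mathcomp Require Import all_boot all_order all_algebra.
From mathcomp Require Import all_classical all_reals all_analysis.

Set Implicit Arguments.
Unset Strict Implicit.
Unset Printing Implicit Defensive.
Import Order.TTheory GRing.Theory Num.Theory.
Import numFieldNormedType.Exports.
Local Open Scope classical_set_scope.
Local Open Scope ring_scope.

(* A function on (0,oo) is represented by a total function on R, of which only
   the values on `]0,+oo[ are used; an element of L_1(0,oo) is represented by
   any of its representatives, as everything below is invariant under
   a.e.-equality on `]0,+oo[. *)
Definition in_L1 (R : realType) (f : R -> R) : Prop :=
  (@lebesgue_measure R).-integrable `]0, +oo[ (EFin \o f).

(* The supremum of F over K, taken in [0,+oo]: it is used for nonnegative F
   only, and adding 0 just makes the supremum over the empty set equal to 0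
   instead of -oo. *)
Definition nneg_sup (R : realType) (T : Type) (K : set T) (F : T -> \bar R)
    : \bar R :=
  ereal_sup ([set 0%E] `|` [set F f | f in K]).

Definition L1_bounded (R : realType) (K : set (R -> R)) : Prop :=
  exists M : R, forall f, K f ->
    (\int[@lebesgue_measure R]_(x in `]0%R, +oo[) `|(f x)%:E| <= M%:E)%E.

(* The value is +oo when there is no admissible s (e.g. at t = 0 when f is
   essentially unbounded). *)
Definition rearrangement (R : realType) (f : R -> R) (t : R) : \bar R :=
  ereal_inf [set s%:E | s in [set s : R | 0 <= s /\
    (@lebesgue_measure R (`]0%R, +oo[ `&` [set x | (s < `|f x|)%R])
       <= t%:E)%E]].

Definition submajorized (R : realType) (f g : R -> R) : Prop :=
  forall t : R, 0 <= t ->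
    (\int[@lebesgue_measure R]_(s in `[0%R, t]) rearrangement f s
       <= \int[@lebesgue_measure R]_(s in `[0%R, t]) rearrangement g s)%E.

(* Only the values of G on [0,oo) are constrained; +oo is an allowed value,
   with the convention 0 * +oo = 0 in the convexity inequality. *)
Definition orlicz_function (R : realType) (G : R -> \bar R) : Prop :=
  [/\ forall t, 0 <= t -> (0 <= G t)%E,
      G 0 = 0%E,
      exists2 t, 0 <= t & G t <> 0%E,
      forall x y l : R, 0 <= x -> 0 <= y -> 0 <= l -> l <= 1 ->
        (G (l * x + (1 - l) * y)%R <= l%:E * G x + (1 - l)%:E * G y)%E
    & G t @[t --> (0 : R)^'+] --> G 0].

(* Main.v *)
Require Import Defs.
From HB Require Import structures.
From mathcomp Require Import all_boot all_order all_algebra.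
From mathcomp Require Import all_classical all_reals all_analysis.
From mathcomp Require Import measurable_realfun lra.

Set Implicit Arguments.
Unset Strict Implicit.
Unset Printing Implicit Defensive.
Import Order.TTheory GRing.Theory Num.Theory.
Import numFieldNormedType.Exports.
Local Open Scope classical_set_scope.
Local Open Scope ring_scope.

(** For l >= 0 put phi_f(l) = int (|f| - l)_+. Layer cake gives
    int_0^t mu(s,f) ds = int_0^oo min(t, d_f(r)) dr, where d_f is the
    distribution function of |f|. Splitting the last integral at l,
    int_0^t mu(s,f) ds <= l t + phi_f(l), with equality for t = d_f(l). Both
    conditions say that phi_f tends to 0 at infinity uniformly in f in K.
    If f is submajorized by g then phi_f <= phi_g, and
    G(t) = sum_n (t - l_n)_+ works as soon as phi_g(l_n) <= 2^-(n+1).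
    Conversely, superlinearity of G makes phi_f small uniformly in f, hence
    int_0^b_n mu(s,f) ds <= a_(n+1) on K for some b_n -> 0, where the a_n are
    summable and a_0 bounds K; then g = sum_n (a_n / b_n) 1_(0,b_n). *)

(** * Monotonicity of the integral and the layer-cake formula *)

(** The integral of a nonnegative function is a supremum over the simple functions below it, and
    this family grows with the function. The main application is to [G |f x|], about whose
    measurability nothing is assumed. *)
Lemma ge0_le_integral_nonmeasurable d (T : measurableType d) (R : realType)
    (m : {measure set T -> \bar R}) (D : set T) (f g : T -> \bar R) :
  (forall x, D x -> (0 <= f x)%E) -> (forall x, D x -> (f x <= g x)%E) ->
  (\int[m]_(x in D) f x <= \int[m]_(x in D) g x)%E.
Proof.
move=> f0 fg; have g0 x : D x -> (0 <= g x)%E.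
  by move=> Dx; apply: le_trans (f0 _ Dx) (fg _ Dx).
rewrite !ge0_integralE//; apply: ereal_sup_le => _ [h hf <-].
by exists h => //= x; apply: le_trans (hf x) (lee_restrict _ _).
Qed.

Lemma measurable_subgraph d (T : measurableType d) (R : realType)
    (D : set T) (h : T -> \bar R) (A : set R) :
  measurable D -> measurable A -> measurable_fun D h ->
  measurable [set p : T * measurableTypeR R |
    [/\ D p.1, A p.2 & (p.2%:E < h p.1)%E]].
Proof.
move=> mD mA mh.
(* Extending by 0 outside [D] makes the comparison measurable on the whole product; intersecting
   with [D] removes the added points. *)
pose h' := h \_ D.
have mh' : measurable_fun setT h' by apply/(measurable_restrictT _ _).1.
have mlt : measurable_fun setT
    (fun p : T * measurableTypeR R => (p.2%:E < h' p.1)%E).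
  apply: measurable_fun_lte.
    by apply/measurable_EFinP; exact: measurable_snd.
  by apply: measurableT_comp => //; exact: measurable_fst.
rewrite [X in measurable X](_ : _ = (D `*` A) `&`
    ((fun p : T * measurableTypeR R => (p.2%:E < h' p.1)%E) @^-1` [set true])).
  apply: measurableI; first exact: measurableX.
  by rewrite -[X in measurable X]setTI; exact: mlt.
apply/seteqP; split=> -[x s] /=.
  by move=> [Dx As] sh; split=> //; rewrite /h' patchE mem_set.
by move=> [[Dx As]]; rewrite /h' patchE mem_set.
Qed.

(** Tonelli for the indicator of the subgraph of [h] over [D], with levels restricted to [A]. The
    choice of [A] as a half-line from [l] yields the excess over [l], and from 0 it yields [h]
    itself when [h] is nonnegative. *)
Lemma layer_cake d (T : measurableType d) (R : realType)
    (m : {sigma_finite_measure set T -> \bar R})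
    (D : set T) (h : T -> \bar R) (A : set R) :
  measurable D -> measurable A -> measurable_fun D h ->
  (\int[m]_(x in D) @lebesgue_measure R (A `&` [set s | s%:E < h x])
   = \int[@lebesgue_measure R]_(s in A) m (D `&` [set x | s%:E < h x]))%E.
Proof.
move=> mD mA mh.
have mE := measurable_subgraph mD mA mh.
set E := (X in measurable X) in mE.
pose mu : {sigma_finite_measure set (measurableTypeR R) -> \bar R} :=
  @lebesgue_measure R.
have := indic_fubini_tonelli m mu mE.
rewrite indic_fubini_tonelli_FE// indic_fubini_tonelli_GE//.
move=> H; rewrite integral_mkcond [RHS]integral_mkcond.
transitivity (\int[m]_x (mu \o xsection E) x)%E.
  apply: eq_integral => x _; rewrite patchE/=.
  case: ifPn; rewrite ?(inE, notin_setE) => Dx; last first.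
    rewrite (_ : xsection E x = set0) ?measure0//.
    by apply/seteqP; split=> s // /xsectionP[].
  congr (lebesgue_measure _); apply/seteqP; split=> s /=.
    by case=> As sh; apply/xsectionP.
  by move=> /xsectionP[].
rewrite H; apply: eq_integral => s _; rewrite patchE/=.
case: ifPn; rewrite ?(inE, notin_setE) => As; last first.
  rewrite (_ : ysection E s = set0) ?measure0//.
  by apply/seteqP; split=> x // /ysectionP[].
congr (m _); apply/seteqP; split=> x /=.
  by move=> /ysectionP[].
by case=> Dx sh; apply/ysectionP.
Qed.

(** * Distribution function and decreasing rearrangement *)

Definition distribution_function (R : realType) (f : R -> R) (s : R) : \bar R :=
  @lebesgue_measure R (`]0%R, +oo[ `&` [set x | s < `|f x|]).

Lemma measurable_superlevel (R : realType) (f : R -> R) (s : R) :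
  measurable_fun (`]0%R, +oo[ : set R) f ->
  measurable ((`]0%R, +oo[ : set R) `&` [set x | s < `|f x|]).
Proof.
move=> mf.
have mnf : measurable_fun (`]0%R, +oo[ : set R) (fun x => `|f x|%:E).
  apply/measurable_EFinP; exact: measurableT_comp.
exact: emeasurable_fun_o_infty (measurable_itv `]0%R, +oo[) mnf s%:E.
Qed.

Lemma distribution_function_nonincreasing (R : realType) (f : R -> R) (a b : R) :
  measurable_fun (`]0%R, +oo[ : set R) f -> a <= b ->
  (distribution_function f b <= distribution_function f a)%E.
Proof.
move=> mf ab; apply: le_measure; rewrite ?inE; [exact: measurable_superlevel..|].
by move=> x [x0 /= bx]; split=> //=; apply: le_lt_trans bx.
Qed.

Lemma measurable_distribution_function (R : realType) (f : R -> R) (A : set R) :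
  measurable_fun (`]0%R, +oo[ : set R) f -> measurable_fun A (distribution_function f).
Proof.
move=> mf; apply: measurable_funTS => mT.
apply: (measurability _ (ErealGenOInfty.measurableE R)) => // _ [_ [r ->] <-].
rewrite setTI preimage_itvoy; apply: is_interval_measurable => x y /= xr yr z.
move=> /andP[xz zy]; apply: lt_le_trans yr _.
exact: distribution_function_nonincreasing.
Qed.

(** Right-continuity of the distribution function: the sets where |f| > r + 1/(n+1) increase to the
    set where |f| > r, and the measure is continuous from below. *)
Lemma distribution_function_right_lt (R : realType) (f : R -> R) (s r : R) :
  measurable_fun (`]0%R, +oo[ : set R) f -> (s%:E < distribution_function f r)%E ->
  exists2 r' : R, r < r' & (s%:E < distribution_function f r')%E.
Proof.
move=> mf sr; pose F n := `]0%R, +oo[ `&` [set x | r + n.+1%:R^-1 < `|f x|].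
have mF n : measurable (F n) by exact: measurable_superlevel.
have UF : \bigcup_n F n = `]0%R, +oo[ `&` [set x | r < `|f x|].
  apply/seteqP; split=> x.
    by move=> [n _ [x0 /= rx]]; split=> //=; apply: lt_trans rx; rewrite ltrDl.
  move=> [x0 /= rx]; have := rx; rewrite -subr_gt0 => /ltr_add_invr.
  move=> [n]; rewrite add0r => nx.
  by exists n => //; split=> //=; rewrite -ltrBrDl.
have ndF : {homo F : n m / (n <= m)%N >-> (n <= m)%O}.
  move=> n m nm; apply/subsetPset => x [x0 /= rx]; split=> //=.
  by apply: le_lt_trans rx; rewrite lerD2l lef_pV2 ?posrE// ler_nat.
have mUF : measurable (\bigcup_n F n) by rewrite UF; exact: measurable_superlevel.
have := @nondecreasing_cvg_mu _ _ _ (@lebesgue_measure R) _ mF mUF ndF.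
rewrite UF => cF; apply: contrapT => H; move: sr; apply/negP; rewrite -leNgt.
apply: cvge_to_le cF _.
apply: nearW => n /=; rewrite leNgt; apply/negP => sn; apply: H.
by exists (r + n.+1%:R^-1); rewrite ?ltrDl.
Qed.

Lemma rearrangement_ge0 (R : realType) (f : R -> R) (t : R) :
  (0 <= rearrangement f t)%E.
Proof. by apply: le_ereal_inf_tmp => _ [s [s0 _] <-]; rewrite lee_fin. Qed.

(** The rearrangement is a generalized inverse of the distribution function. From right to left,
    right-continuity supplies a level [r'] > [r] that still bounds every admissible [s] from below,
    so the infimum stays strictly above [r]. *)
Lemma lt_rearrangement (R : realType) (f : R -> R) (t r : R) :
  measurable_fun (`]0%R, +oo[ : set R) f -> 0 <= r ->
  (r%:E < rearrangement f t)%E = (t%:E < distribution_function f r)%E.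
Proof.
move=> mf r0; apply/idP/idP => [|tr].
  rewrite !ltNge; apply: contra => dt.
  by apply: ereal_inf_lbound; exists r.
have [r' rr' tr'] := distribution_function_right_lt mf tr.
apply: (@lt_le_trans _ _ r'%:E); first by rewrite lte_fin.
apply: le_ereal_inf_tmp => _ [s [s0 ds] <-]; rewrite lee_fin leNgt; apply/negP => sr'.
move: tr'; apply/negP; rewrite -leNgt; apply: le_trans ds.
by apply: distribution_function_nonincreasing => //; exact: ltW.
Qed.

Lemma measurable_rearrangement (R : realType) (f : R -> R) (A : set R) :
  measurable_fun (`]0%R, +oo[ : set R) f -> measurable_fun A (rearrangement f).
Proof.
move=> mf; apply: measurable_funTS => mT.
apply: (measurability _ (ErealGenOInfty.measurableE R)) => // _ [_ [r ->] <-].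
rewrite setTI preimage_itvoy; have [r0|r0] := leP 0 r.
  under eq_set do rewrite lt_rearrangement//.
  apply: is_interval_measurable => x y /= xr yr z /andP[_ zy].
  by apply: le_lt_trans yr; rewrite lee_fin.
rewrite (_ : [set x | _] = setT)//; apply/seteqP; split=> x //= _.
by apply: lt_le_trans (rearrangement_ge0 _ _); rewrite lte_fin.
Qed.

(** * Excess and rearrangement as integrals of the distribution function *)

Lemma lebesgue_measure_above_below (R : realType) (l y : R) :
  @lebesgue_measure R (`[l, +oo[ `&` [set s | (s%:E < y%:E)%E])
  = (Num.max (y - l) 0)%:E.
Proof.
rewrite (_ : _ `&` _ = `[l, y[%classic); last first.
  apply/seteqP; split=> s /=; rewrite !in_itv/= ?andbT lte_fin.
    by move=> [-> ->].
  by move=> /andP[-> ->].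
rewrite lebesgue_measure_itv/= lte_fin; case: ltP => ly.
  by rewrite -EFinB max_l// subr_ge0 ltW.
by rewrite max_r// subr_le0.
Qed.

Lemma lebesgue_measure_ge0_below (R : realType) (a : \bar R) : (0 <= a)%E ->
  @lebesgue_measure R (`[0%R, +oo[ `&` [set s | (s%:E < a)%E]) = a.
Proof.
case: a => [y y0||//].
  by rewrite lebesgue_measure_above_below subr0 max_l.
move=> _; rewrite (_ : _ `&` _ = `[0%R, +oo[%classic).
  by rewrite lebesgue_measure_itv/= ltry.
by apply/seteqP; split=> s /= => [[]//|->]; rewrite ltry.
Qed.

Lemma integral_excess (R : realType) (f : R -> R) (l : R) :
  measurable_fun (`]0%R, +oo[ : set R) f ->
  (\int[@lebesgue_measure R]_(x in `]0%R, +oo[) (Num.max (`|f x| - l) 0)%:E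
   = \int[@lebesgue_measure R]_(s in `[l, +oo[) distribution_function f s)%E.
Proof.
move=> mf.
have mnf : measurable_fun (`]0%R, +oo[ : set R) (fun x => `|f x|%:E).
  apply/measurable_EFinP; exact: measurableT_comp.
have := @layer_cake _ _ R (@lebesgue_measure R) _ _ _
  (measurable_itv `]0%R, +oo[) (measurable_itv `[l, +oo[) mnf.
under eq_integral do rewrite lebesgue_measure_above_below.
by move=> ->; apply: eq_integral => s _; congr (lebesgue_measure (_ `&` _)).
Qed.

(** Layer cake for the rearrangement on [0,t]: by [lt_rearrangement] its superlevel set at [r] is
    [0,t] cut by s < d_f(r), of length min(t, d_f(r)). *)
Lemma integral_rearrangement (R : realType) (f : R -> R) (t : R) :
  measurable_fun (`]0%R, +oo[ : set R) f -> 0 <= t ->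
  (\int[@lebesgue_measure R]_(s in `[0%R, t]) rearrangement f s
   = \int[@lebesgue_measure R]_(r in `[0%R, +oo[)
       Order.min t%:E (distribution_function f r))%E.
Proof.
move=> mf t0.
have := @layer_cake _ _ R (@lebesgue_measure R) _ _ _
  (measurable_itv `[0%R, t]) (measurable_itv `[0%R, +oo[)
  (measurable_rearrangement mf).
under eq_integral do rewrite lebesgue_measure_ge0_below ?rearrangement_ge0//.
move=> ->; apply: eq_integral => r; rewrite inE/= in_itv/= andbT => r0.
have -> : [set s | (r%:E < rearrangement f s)%E]
    = [set s | (s%:E < distribution_function f r)%E].
  by apply/eq_set => s; rewrite lt_rearrangement.
have d0 : (0 <= distribution_function f r)%E by exact: measure_ge0.
case: ltP => td.
  rewrite (_ : _ `&` _ = `[0%R, t]%classic).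
    rewrite lebesgue_measure_itv/= lte_fin.
    by case: ltgtP t0 => // [_|<-] _; rewrite -?EFinB ?subr0.
  apply/seteqP; split=> s /=; first by case.
  rewrite in_itv/= => /andP[s0 st]; rewrite s0 st; split=> //.
  by apply: le_lt_trans td; rewrite lee_fin.
move: d0 td; case: (distribution_function f r) => [y||]// y0 yt.
rewrite (_ : _ `&` _ = `[0%R, y[%classic).
  rewrite lebesgue_measure_itv/= lte_fin.
  by move: y0; rewrite lee_fin; case: ltgtP => // [_|<-] _; rewrite -?EFinB ?subr0.
apply/seteqP; split=> s /=; rewrite !in_itv/= lte_fin.
  by move=> [/andP[-> _] sy].
move=> /andP[s0 sy]; rewrite s0 sy; split=> //=.
by apply: le_trans (ltW sy) _; rewrite -lee_fin.
Qed.

Lemma ge0_integral_split (R : realType) (l : R) (h : R -> \bar R) : 0 <= l ->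
  measurable_fun setT h -> (forall x, 0 <= h x)%E ->
  (\int[@lebesgue_measure R]_(x in `[0%R, +oo[) h x
   = \int[@lebesgue_measure R]_(x in `[0%R, l[) h x
     + \int[@lebesgue_measure R]_(x in `[l, +oo[) h x)%E.
Proof.
move=> l0 mh h0.
have -> : `[0%R, +oo[%classic = (`[0%R, l[ `|` `[l, +oo[)%classic.
  apply/seteqP; split=> x /=; rewrite !in_itv/= ?andbT.
    by move=> ->; case: ltP; [left|right].
  by case=> [/andP[]//|]; exact: le_trans.
rewrite ge0_integral_setU//; first exact: measurable_funTS.
apply/disj_setPS => x /= [].
by rewrite !in_itv/= andbT => /andP[_ xl]; rewrite leNgt xl.
Qed.

Section rearrangement_integral_bounds.
Variables (R : realType) (f : R -> R) (l t : R).
Hypotheses (mf : measurable_fun (`]0%R, +oo[ : set R) f) (l0 : 0 <= l) (t0 : 0 <= t).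
Let mu := @lebesgue_measure R.

Let m := fun r => Order.min t%:E (distribution_function f r).

Let m_ge0 r : (0 <= m r)%E.
Proof. by rewrite /m le_min lee_fin t0 measure_ge0. Qed.

Let mm : measurable_fun setT m.
Proof. by apply: measurable_mine => //; exact: measurable_distribution_function. Qed.

(** In min(t, d_f), keep [t] for levels below [l] and d_f for levels above. *)
Lemma integral_rearrangement_le :
  (\int[mu]_(s in `[0%R, t]) rearrangement f s
   <= (l * t)%:E + \int[mu]_(x in `]0%R, +oo[) (Num.max (`|f x| - l) 0)%:E)%E.
Proof.
rewrite integral_rearrangement// (ge0_integral_split l0)//.
rewrite integral_excess//; apply: leeD; last first.
  apply: ge0_le_integral_nonmeasurable => r _; first exact: m_ge0.
  by rewrite ge_min lexx orbT.
apply: (@le_trans _ _ (\int[mu]_(x in `[0%R, l[) t%:E)%E).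
  apply: ge0_le_integral_nonmeasurable => r _; first exact: m_ge0.
  by rewrite ge_min lexx.
rewrite integral_cst//= lebesgue_measure_itv/= lte_fin.
case: ltgtP l0 => // [_|<-] _; last by rewrite mule0 mul0r.
by rewrite -EFinB subr0 -EFinM mulrC.
Qed.

(** Since d_f is nonincreasing with value [t] at [l], the minimum equals [t] below [l] and d_f
    above, so the upper estimate is attained. *)
Lemma integral_rearrangement_ge : distribution_function f l = t%:E ->
  ((l * t)%:E + \int[mu]_(x in `]0%R, +oo[) (Num.max (`|f x| - l) 0)%:E
   <= \int[mu]_(s in `[0%R, t]) rearrangement f s)%E.
Proof.
move=> dt; rewrite integral_rearrangement// (ge0_integral_split l0)//.
rewrite integral_excess//; apply: leeD; last first.
  apply: ge0_le_integral_nonmeasurable => r; first by rewrite measure_ge0.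
  rewrite /= in_itv/= andbT => lr.
  by rewrite le_min lexx andbT -dt; exact: distribution_function_nonincreasing.
apply: (@le_trans _ _ (\int[mu]_(x in `[0%R, l[) t%:E)%E).
  rewrite integral_cst//= lebesgue_measure_itv/= lte_fin.
  case: ltgtP l0 => // [_|<-] _; last by rewrite mule0 mul0r.
  by rewrite -EFinB subr0 -EFinM mulrC.
apply: ge0_le_integral_nonmeasurable => r /=; first by rewrite lee_fin.
rewrite in_itv/= => /andP[_ rl]; rewrite le_min lexx -dt.
by apply: distribution_function_nonincreasing => //; exact: ltW.
Qed.

End rearrangement_integral_bounds.

(** * Excess of integrable functions and its comparison under submajorization *)

Lemma in_L1_measurable (R : realType) (f : R -> R) :
  in_L1 f -> measurable_fun (`]0%R, +oo[ : set R) f.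
Proof. by move=> /integrableP[/measurable_EFinP]. Qed.

(** Chebyshev's inequality. Finiteness allows the real number t = d_f(l) to be used as an endpoint
    of integration. *)
Lemma distribution_function_fin_num (R : realType) (f : R -> R) (l : R) :
  in_L1 f -> 0 < l -> distribution_function f l \is a fin_num.
Proof.
move=> /integrableP[mf foo] l0.
have mf' := (measurable_EFinP _ _).1 mf.
have mabs : measurable_fun (`]0%R, +oo[ : set R) (fun x => `|(EFin \o f) x|%E).
  exact: measurableT_comp.
pose S := (`]0%R, +oo[ : set R) `&` [set x | (l%:E <= `|(EFin \o f) x|)%E].
have lS : (l%:E * @lebesgue_measure R S < +oo)%E :=
  le_lt_trans (le_integral_abse (@lebesgue_measure R)
    (measurable_itv `]0%R, +oo[) mf l0) foo.
rewrite ge0_fin_numE ?measure_ge0//.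
apply: (@le_lt_trans _ _ (lebesgue_measure S)).
  apply: le_measure; rewrite ?inE.
  - exact: measurable_superlevel.
  - exact: emeasurable_fun_c_infty (measurable_itv _) mabs _.
  - by move=> x [x0 /= lx]; split=> //=; rewrite lee_fin ltW.
rewrite ltey; apply/eqP => Soo; move: lS.
by rewrite Soo gt0_muley ?lte_fin// ltxx.
Qed.

(** Test submajorization at t = d_f(l): the lower estimate is an equality case for [f], the upper
    one holds for [g] at any [t], and the finite term l t cancels. *)
Lemma submajorized_excess_le (R : realType) (f g : R -> R) (l : R) : 0 < l ->
  in_L1 f -> measurable_fun (`]0%R, +oo[ : set R) g -> submajorized f g ->
  (\int[@lebesgue_measure R]_(x in `]0%R, +oo[) (Num.max (`|f x| - l) 0)%:E
   <= \int[@lebesgue_measure R]_(x in `]0%R, +oo[) (Num.max (`|g x| - l) 0)%:E)%E.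
Proof.
move=> l0 f1 mg fg.
have /fineK/esym dt := distribution_function_fin_num f1 l0.
set t := fine _ in dt.
have t0 : 0 <= t by rewrite -lee_fin -dt measure_ge0.
rewrite -(@leeD2lE _ (l * t)%:E)//.
apply: le_trans (integral_rearrangement_ge (in_L1_measurable f1) (ltW l0) t0 dt) _.
apply: le_trans (fg _ t0) _.
exact: integral_rearrangement_le (ltW l0) t0.
Qed.

(** Dominated convergence with dominating function |g|, along the thresholds n + 1. Keeping [1 <= l]
    will make the Orlicz function vanish near zero. *)
Lemma in_L1_excess_small (R : realType) (g : R -> R) (e : R) : in_L1 g -> 0 < e ->
  exists2 l : R, 1 <= l &
  (\int[@lebesgue_measure R]_(x in `]0%R, +oo[) (Num.max (`|g x| - l) 0)%:E
   <= e%:E)%E.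
Proof.
move=> g1 e0; have mg := in_L1_measurable g1.
pose h n x := (Num.max (`|g x| - n.+1%:R) 0)%:E.
have mh n : measurable_fun (`]0%R, +oo[ : set R) (h n).
  apply/measurable_EFinP; apply: measurable_maxr => //.
  apply: measurable_funB => //; exact: measurableT_comp.
have := @dominated_convergence _ _ R (@lebesgue_measure R) `]0%R, +oo[
  (measurable_itv _) h (cst 0%E) (fun x => `|g x|%:E) mh (measurable_cst _).
move=> [|||_ _].
- apply: aeW => x _; apply: cvg_near_cst.
  near=> n; rewrite /h max_r// subr_le0.
  apply: (@le_trans _ _ n%:R); last by rewrite ler_nat.
  by near: n; exact: nbhs_infty_ger.
- exact: integrable_abse g1.
- apply: aeW => x n _; rewrite /h gee0_abs ?lee_fin ?le_max ?lexx ?orbT//.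
  by rewrite ge_max lerBlDr lerDl !ler0n normr_ge0.
rewrite integral0 => h_cvg0; apply: contrapT => no_l.
have : (e%:E <= 0)%E; last by rewrite lee_fin leNgt e0.
apply: cvge_to_ge h_cvg0 _; apply: nearW => n; rewrite leNgt; apply/negP => hn.
by apply: no_l; exists n.+1%:R; rewrite ?ler1n//; exact: ltW.
Unshelve. all: by end_near. Qed.

(** * A superlinear Orlicz function built from thresholds *)

Section orlicz_of_thresholds.
Variables (R : realType) (l : nat -> R).
Hypothesis l1 : forall n, 1 <= l n.

(** Only [1 <= l n] is known, so the series may diverge; hence the extended real values. *)
Definition excess_series (t : R) : \bar R :=
  (\sum_(0 <= n <oo) (Num.max (t - l n) 0)%:E)%E.

Let term_ge0 t n : (0 <= (Num.max (t - l n) 0)%:E)%E.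
Proof. by rewrite lee_fin le_max lexx orbT. Qed.

Lemma excess_series_eq0 t : t <= 1 -> excess_series t = 0%E.
Proof.
move=> t1; apply: eseries0 => n _ _.
by rewrite max_r// subr_le0 (le_trans t1).
Qed.

(** Convexity holds term by term, and thresholds at least 1 make the series vanish up to 1, which
    settles the value and the continuity at zero. *)
Lemma orlicz_excess_series : orlicz_function excess_series.
Proof.
split.
- by move=> t _; apply: nneseries_ge0.
- by rewrite excess_series_eq0.
(* At this point the term of index 0 alone equals 1. *)
- exists (l 0%N + 1); first by rewrite addr_ge0// (le_trans _ (l1 0%N)).
  apply/eqP; rewrite gt_eqF//.
  apply: lt_le_trans (nneseries_lim_ge 1%N _) => //.
  by rewrite big_nat1 lte_fin addrAC subrr add0r lt_max ltr01.
- move=> x y a x0 y0 a0 a1; have a'0 : 0 <= 1 - a by rewrite subr_ge0.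
  rewrite /excess_series -!nneseriesZl//.
  rewrite -nneseriesD; [|by move=> n _ _; rewrite mule_ge0..].
  apply: lee_nneseries => // n _; rewrite -!EFinM -EFinD lee_fin ge_max.
  apply/andP; split; last first.
    by rewrite addr_ge0// mulr_ge0// le_max lexx orbT.
  have -> : a * x + (1 - a) * y - l n = a * (x - l n) + (1 - a) * (y - l n).
    by lra.
  by apply: lerD; apply: ler_wpM2l => //; rewrite le_max lexx.
- rewrite excess_series_eq0//; apply: cvg_near_cst.
  near=> t; apply: excess_series_eq0.
  by near: t; exact: nbhs_right_le.
Unshelve. all: by end_near. Qed.

(** Once t is at least twice each of the first n + 1 thresholds, each of the corresponding terms is
    at least t/2, so the quotient by t is at least (n + 1)/2. *)
Lemma excess_series_superlinear :
  (excess_series t * (t^-1)%:E)%E @[t --> +oo] --> +oo%E.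
Proof.
apply/cvgeyPge => A.
pose n := Num.truncn (2 * `|A|).
have An : A <= n.+1%:R / 2.
  have := truncnS_gt (2 * `|A|); rewrite -/n => nA.
  by have := ler_norm A; lra.
pose T := \sum_(i < n.+1) l i.
have lT (i : 'I_n.+1) : l i <= T.
  rewrite /T (bigD1 i)//= lerDl sumr_ge0// => j _.
  exact: le_trans (l1 j).
near=> t.
have tT : 2 * T <= t by near: t; apply: nbhs_pinfty_ge; exact: num_real.
have T1 : 1 <= T by apply: le_trans (lT ord0).
have t0 : 0 < t by lra.
rewrite lee_pdivlMr//.
apply: le_trans (nneseries_lim_ge n.+1 _) => //.
rewrite sumEFin -EFinM lee_fin big_mkord.
apply: (@le_trans _ _ (\sum_(i < n.+1) t / 2)).
  by rewrite sumr_const card_ord -mulr_natl; nra.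
apply: ler_sum => i _; rewrite le_max; apply/orP; left.
by have := lT i; lra.
Unshelve. all: by end_near. Qed.

End orlicz_of_thresholds.

(** * Passing between Orlicz bounds and smallness of the excess, uniformly on [K] *)

Lemma nneg_sup_lty (R : realType) (T : Type) (K : set T) (F : T -> \bar R) (C : R) :
  (forall f, K f -> (F f <= C%:E)%E) -> (nneg_sup K F < +oo)%E.
Proof.
move=> FC; apply: (@le_lt_trans _ _ (Num.max C 0)%:E); last exact: ltry.
apply: ge_ereal_sup => _ [->|[f Kf <-]]; first by rewrite lee_fin le_max lexx orbT.
by apply: le_trans (FC _ Kf) _; rewrite lee_fin le_max lexx.
Qed.

Lemma nneg_sup_lty_bounded (R : realType) (T : Type) (K : set T) (F : T -> \bar R) :
  (nneg_sup K F < +oo)%E -> exists2 C : R, 0 < C & forall f, K f -> (F f <= C%:E)%E.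
Proof.
move=> Foo; have F0 : (0 <= nneg_sup K F)%E by apply: ereal_sup_ubound; left.
exists (fine (nneg_sup K F) + 1); first by rewrite ltr_wpDl// fine_ge0.
move=> f Kf; apply: (@le_trans _ _ (nneg_sup K F)).
  by apply: ereal_sup_ubound; right; exists f.
by rewrite EFinD fineK ?ge0_fin_numE// leeDl.
Qed.

Lemma sum_half_pow (R : realType) (r : R) :
  (\sum_(0 <= n <oo) (r / (2 ^ n.+1)%:R)%:E = r%:E)%E.
Proof.
apply/cvg_lim => //.
have := @cvg_geometric_eseries_half R r 0; rewrite expr0 divr1.
by under [X in X @ _ --> _ -> _]eq_fun do under eq_bigr do rewrite addn1.
Qed.

Lemma orlicz_of_submajorized (R : realType) (K : set (R -> R)) (g : R -> R) :
  (forall f, K f -> in_L1 f) -> in_L1 g ->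
  (forall f, K f -> submajorized (fun x => `|f x|) g) ->
  exists G : R -> \bar R,
     [/\ orlicz_function G,
         (G t * (t^-1)%:E)%E @[t --> +oo] --> +oo%E
       & (nneg_sup K (fun f => \int[@lebesgue_measure R]_(s in `]0%R, +oo[)
            G `|f s|%R) < +oo)%E].
Proof.
move=> K_L1 g1 Kg.
have small n : exists l : R, 1 <= l /\
    (\int[@lebesgue_measure R]_(x in `]0%R, +oo[) (Num.max (`|g x| - l) 0)%:E
     <= (1 / (2 ^ n.+1)%:R)%:E)%E.
  have [|l l1 gl] := @in_L1_excess_small R g (1 / (2 ^ n.+1)%:R) g1.
    by rewrite divr_gt0// ltr0n expn_gt0.
  by exists l.
have [l hl] := choice small.
have l1 n : 1 <= l n by case: (hl n).
exists (excess_series l); split.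
- exact: orlicz_excess_series.
- exact: excess_series_superlinear.
(* The bound 1 is the sum of the 2^-(n+1): integrating the series termwise gives the excesses of f
   over the [l n], each at most that of [g]. *)
apply: (@nneg_sup_lty _ _ _ _ 1) => f Kf.
have mf := in_L1_measurable (K_L1 f Kf).
rewrite integral_nneseries//; last 2 first.
- move=> n; apply/measurable_EFinP; apply: measurable_maxr => //.
  apply: measurable_funB => //; exact: measurableT_comp.
- by move=> n x _; rewrite lee_fin le_max lexx orbT.
rewrite -(sum_half_pow 1); apply: lee_nneseries => n _.
  by move=> _; apply: integral_ge0 => x _; rewrite lee_fin le_max lexx orbT.
apply: le_trans (proj2 (hl n)).
have f1 : in_L1 (fun x => `|f x|) by exact: integrable_abse (K_L1 f Kf).
have ln0 : 0 < l n by exact: lt_le_trans (l1 n).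
apply: le_trans (submajorized_excess_le ln0 f1 (in_L1_measurable g1) (Kg f Kf)).
by under [leRHS]eq_integral do rewrite normr_id.
Qed.

Lemma orlicz_excess_small (R : realType) (K : set (R -> R)) (G : R -> \bar R) (e : R) :
  (forall f, K f -> in_L1 f) -> orlicz_function G ->
  (G t * (t^-1)%:E)%E @[t --> +oo] --> +oo%E ->
  (nneg_sup K (fun f => \int[@lebesgue_measure R]_(s in `]0%R, +oo[)
     G `|f s|%R) < +oo)%E ->
  0 < e ->
  exists2 l : R, 0 <= l & forall f, K f ->
  (\int[@lebesgue_measure R]_(x in `]0%R, +oo[) (Num.max (`|f x| - l) 0)%:E
   <= e%:E)%E.
Proof.
move=> K_L1 [G0 _ _ _ _] /cvgeyPge Goo /nneg_sup_lty_bounded[C C0 GC] e0.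
(* Beyond [M] the slope G(t)/t is at least C/e, where [C] bounds the integrals of G(|f|); then C/e
   times the excess over [l] is at most [C]. *)
have [M [_ hM]] := Goo (C / e).
have Ce : 0 < C / e by exact: divr_gt0.
pose l := Num.max M 0; have l0 : 0 <= l by rewrite le_max lexx orbT.
exists l => // f Kf.
have mf := in_L1_measurable (K_L1 f Kf).
rewrite -(@lee_pmul2l _ (C / e)%:E)// ?lte_fin// -EFinM divfK ?gt_eqF//.
have pos x : (0 <= (Num.max (`|f x| - l) 0)%:E)%E.
  by rewrite lee_fin le_max lexx orbT.
rewrite -ge0_integralZl_EFin ?(ltW Ce)//; last first.
  apply/measurable_EFinP; apply: measurable_maxr => //.
  apply: measurable_funB => //; exact: measurableT_comp.
apply: le_trans (GC f Kf).
apply: ge0_le_integral_nonmeasurable => x _.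
  by rewrite mule_ge0// lee_fin ltW.
have [fl|lf] := leP `|f x| l.
  by rewrite max_r ?subr_le0// mule0 G0.
have fx0 : 0 < `|f x| by exact: le_lt_trans lf.
have := hM `|f x|; rewrite /= lee_pdivlMr// => H.
apply: le_trans (H _); last by apply: le_lt_trans lf; rewrite le_max lexx.
rewrite -EFinM lee_fin ler_wpM2l ?(ltW Ce)//.
by rewrite ge_max normr_ge0 andbT lerBlDr lerDl.
Qed.

(** * Construction of an integrable majorant *)

(** For s < b, a level r < c is not admissible in the infimum defining the rearrangement at s,
    because |g| > r on all of (0,b), of measure b > s. So the rearrangement is at least c on
    [0,b). *)
Lemma integral_rearrangement_lower (R : realType) (g : R -> R) (c b t : R) :
  measurable_fun (`]0%R, +oo[ : set R) g -> 0 <= c -> 0 < b -> b <= t ->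
  (forall x, 0 < x < b -> c <= `|g x|) ->
  ((c * b)%:E <= \int[@lebesgue_measure R]_(s in `[0%R, t]) rearrangement g s)%E.
Proof.
move=> mg c0 b0 bt cg.
apply: (@le_trans _ _ (\int[@lebesgue_measure R]_(s in `[0%R, b[)
  rearrangement g s)%E); last first.
  apply: ge0_subset_integral => //; first exact: measurable_rearrangement.
    by move=> x _; exact: rearrangement_ge0.
  move=> x /=; rewrite !in_itv/= => /andP[-> xb]/=.
  by apply: ltW; exact: lt_le_trans bt.
apply: (@le_trans _ _ (\int[@lebesgue_measure R]_(s in `[0%R, b[) c%:E)%E).
  by rewrite integral_cst//= lebesgue_measure_itv/= lte_fin b0 -EFinB subr0 -EFinM.
apply: ge0_le_integral_nonmeasurable => s; first by rewrite lee_fin.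
rewrite /= in_itv/= => /andP[s0 sb].
apply: le_ereal_inf_tmp => _ [r [r0 dr] <-]; rewrite lee_fin leNgt.
apply/negP => rc; move: dr; apply/negP; rewrite -ltNge.
apply: (@lt_le_trans _ _ b%:E); first by rewrite lte_fin.
have <- : @lebesgue_measure R `]0%R, b[ = b%:E.
  by rewrite lebesgue_measure_itv/= lte_fin b0 -EFinB subr0.
apply: le_measure; rewrite ?inE//; first exact: measurable_superlevel.
move=> x /=; rewrite in_itv/= => xb; split.
  by rewrite in_itv/= andbT; case/andP: xb.
exact: lt_le_trans (cg _ xb).
Qed.

Section stacked_bumps.
Variables (R : realType) (a b : nat -> R).
Hypotheses (a0 : forall n, 0 <= a n) (b0 : forall n, 0 < b n).
Hypothesis bn : forall n, b n <= n.+1%:R^-1.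
Hypothesis a_summable : (\sum_(0 <= n <oo) (a n)%:E < +oo)%E.

(** The height is chosen so that the block over (0, b n) has integral [a n]. *)
Let bump n (x : R) : \bar R := (a n / b n * \1_(`]0%R, b n[%classic : set R) x)%:E.

Let bump_ge0 n x : (0 <= bump n x)%E.
Proof. by rewrite lee_fin mulr_ge0// divr_ge0// ltW. Qed.

Let measurable_bump n : measurable_fun (`]0%R, +oo[ : set R) (bump n).
Proof. by apply/measurable_EFinP; apply: measurable_funM. Qed.

(* For x > 0 only finitely many terms are nonzero since b n <= 1 / (n + 1), so
   [fine] loses nothing there. *)
Definition bump_sum (x : R) : R := fine (\sum_(0 <= n <oo) bump n x)%E.

Let bump_sumE x : 0 < x -> (bump_sum x)%:E = (\sum_(0 <= n <oo) bump n x)%E.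
Proof.
move=> x0; rewrite fineK//.
have [N] := ltr_add_invr x0; rewrite add0r => Nx.
rewrite (nneseries_split 0 N)// [X in (_ + X)%E]eseries0.
  by rewrite adde0 sum_fin_num; apply/allP => _ /mapP[n _ ->].
move=> n; rewrite add0n => Nn _; rewrite /bump indicE memNset ?mulr0//=.
rewrite in_itv/= x0/=; apply/negP; rewrite -leNgt.
apply: le_trans (bn n) _; apply: le_trans (ltW Nx).
by rewrite lef_pV2 ?posrE// ler_nat.
Qed.

Lemma bump_sum_ge0 x : 0 <= bump_sum x.
Proof. by rewrite fine_ge0// nneseries_ge0. Qed.

Lemma bump_sum_in_L1 : in_L1 bump_sum.
Proof.
have mS : measurable_fun (`]0%R, +oo[ : set R) (fun x => \sum_(0 <= n <oo) bump n x)%E.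
  by apply: (@ge0_emeasurable_sum _ _ _ _ _ xpredT).
apply/integrableP; split.
  by apply/measurable_EFinP; apply: measurableT_comp mS.
under eq_integral => x.
  rewrite inE/= in_itv/= andbT => x0.
  rewrite ger0_norm ?bump_sum_ge0// bump_sumE//.
  over.
rewrite integral_nneseries//; apply: le_lt_trans a_summable.
apply: lee_nneseries => n _; first by move=> _; apply: integral_ge0.
rewrite /bump; under eq_integral do rewrite EFinM.
rewrite ge0_integralZl_EFin//; last 2 first.
- by apply/measurable_EFinP; exact: measurable_indic.
- by rewrite divr_ge0// ltW.
rewrite integral_indic// setIidl; last first.
  by move=> x /=; rewrite !in_itv/= andbT => /andP[].
rewrite /= lebesgue_measure_itv/= lte_fin b0 -EFinB subr0 -EFinM.
by rewrite divfK// gt_eqF.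
Qed.

Lemma bump_sum_ge n x : 0 < x < b n -> a n / b n <= bump_sum x.
Proof.
move=> xb; have /andP[x0 _] := xb; rewrite -lee_fin bump_sumE//.
apply: le_trans (nneseries_lim_ge n.+1 _) => //.
rewrite big_nat_recr//= [X in (_ <= _ + X)%E]/bump indicE mem_set//= mulr1.
by rewrite leeDr// sume_ge0.
Qed.

End stacked_bumps.

Lemma submajorized_of_excess_small (R : realType) (K : set (R -> R)) :
  (forall f, K f -> in_L1 f) -> L1_bounded K ->
  (forall e, 0 < e -> exists2 l : R, 0 <= l & forall f, K f ->
    (\int[@lebesgue_measure R]_(x in `]0%R, +oo[) (Num.max (`|f x| - l) 0)%:E
     <= e%:E)%E) ->
  exists g : R -> R,
     [/\ in_L1 g,
         forall x, 0 < x -> 0 <= g x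
       & forall f, K f -> submajorized (fun x => `|f x|) g].
Proof.
move=> K_L1 [M KM] K_small.
(* The factor 2 makes [a 0] equal to |M| + 1, which is positive and dominates the L1 bound. *)
pose B := 2 * (`|M| + 1); pose a n := B / (2 ^ n.+1)%:R.
have a_gt0 n : 0 < a n.
  by rewrite divr_gt0 ?ltr0n ?expn_gt0// mulr_gt0// ltr_wpDl.
have small n : exists b : R, [/\ 0 < b, b <= n.+1%:R^-1 & forall f, K f ->
    (\int[@lebesgue_measure R]_(s in `[0%R, b]) rearrangement f s
     <= (a n.+1)%:E)%E].
  have [|l l0 Kl] := K_small (a n.+1 / 2); first by rewrite divr_gt0.
  (* The first entry forces b_n to tend to 0; the second gives (l + 1) b <= a_(n+1)/2, with l + 1 in
     the denominator because [l] may be 0. The other half of a_(n+1) absorbs the excess. *)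
  pose b := Num.min n.+1%:R^-1 (a n.+1 / 2 / (l + 1)).
  have l10 : 0 < l + 1 by rewrite ltr_wpDl.
  have b0 : 0 < b by rewrite lt_min invr_gt0 ltr0n/= divr_gt0// divr_gt0.
  exists b; split=> //; first by rewrite ge_min lexx.
  move=> f Kf.
  apply: le_trans (integral_rearrangement_le (in_L1_measurable (K_L1 f Kf)) l0 (ltW b0)) _.
  rewrite [in leRHS](splitr (a n.+1)) EFinD; apply: leeD; last exact: Kl.
  rewrite lee_fin; apply: (@le_trans _ _ ((l + 1) * b)).
    by rewrite ler_wpM2r ?(ltW b0)// lerDl.
  by rewrite mulrC -ler_pdivlMr// ge_min lexx orbT.
have [b hb] := choice small.
have b0 n : 0 < b n by case: (hb n).
have bn n : b n <= n.+1%:R^-1 by case: (hb n).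
have Kb n f : K f -> (\int[@lebesgue_measure R]_(s in `[0%R, b n])
    rearrangement f s <= (a n.+1)%:E)%E by case: (hb n) => _ _; exact.
have a0 n : 0 <= a n by exact: ltW.
have sum_a : (\sum_(0 <= n <oo) (a n)%:E < +oo)%E by rewrite sum_half_pow ltry.
have g1 := bump_sum_in_L1 a0 b0 bn sum_a.
exists (bump_sum a b); split=> //; first by move=> x _; exact: bump_sum_ge0.
move=> f Kf t; rewrite le_eqVlt => /predU1P[<-|t0].
  by rewrite set_itv1 !integral_set1.
have -> : rearrangement (fun x => `|f x|) = rearrangement f.
  apply/funext => s; rewrite /rearrangement; congr (ereal_inf (_ @` _)).
  apply/eq_set => r; congr (_ /\ is_true (lebesgue_measure (_ `&` _) <= _)%E).
  by apply/eq_set => x; rewrite normr_id.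
have mf := in_L1_measurable (K_L1 f Kf).
have lower n : b n <= t -> ((a n)%:E <=
    \int[@lebesgue_measure R]_(s in `[0%R, t]) rearrangement (bump_sum a b) s)%E.
  move=> bt; rewrite -[a n](@divfK _ (b n)) ?gt_eqF//.
  apply: integral_rearrangement_lower => //; first exact: in_L1_measurable.
    by rewrite divr_ge0// ltW.
  move=> x xb; rewrite ger0_norm; first exact: bump_sum_ge.
  exact: bump_sum_ge0.
have ex_n : exists n, b n <= t.
  have [n] := ltr_add_invr t0; rewrite add0r => nt.
  by exists n; apply: le_trans (bn n) (ltW nt).
(* For the least n with b n <= t, the integral of mu(g) over [0, t] is at least
   a n, while that of mu(f) is at most a n because t < b n.-1. *)
case: (ex_minnP ex_n) => -[b0t _|n bnt n_min].
  apply: le_trans (lower _ b0t).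
  (* With index 0 there is no preceding b; the cutoff l = 0 bounds the integral by the L1 norm,
     hence by [M] and by [a 0]. *)
  apply: le_trans (integral_rearrangement_le mf (lexx 0) (ltW t0)) _.
  rewrite mul0r add0e; under eq_integral do rewrite subr0 max_l//.
  apply: le_trans (KM f Kf) _.
  by rewrite lee_fin /a /B expn1 mulrC mulKf//; have := ler_norm M; lra.
apply: le_trans (lower _ bnt); apply: le_trans (Kb n f Kf).
apply: ge0_subset_integral => //; first exact: measurable_rearrangement.
  by move=> x _; exact: rearrangement_ge0.
move=> x /=; rewrite !in_itv/= => /andP[-> xt]/=; apply: le_trans xt _.
by rewrite leNgt; apply/negP => /ltW /n_min; rewrite ltnn.
Qed.

Theorem theorem4p3 (R : realType) (K : set (R -> R))
    (K_L1 : forall f, K f -> in_L1 f)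
    (K_bounded : L1_bounded K)
    (K_tail : nneg_sup K (fun f => (\int[@lebesgue_measure R]_(s in `[N, +oo[)
                 rearrangement f s)%E) @[N --> +oo] --> 0%E) :
  (exists G : R -> \bar R,
     [/\ orlicz_function G,
         (G t * (t^-1)%:E)%E @[t --> +oo] --> +oo%E
       & (nneg_sup K (fun f => \int[@lebesgue_measure R]_(s in `]0%R, +oo[)
            G `|f s|%R) < +oo)%E])
  <->
  (exists g : R -> R,
     [/\ in_L1 g,
         forall x, 0 < x -> 0 <= g x
       & forall f, K f -> submajorized (fun x => `|f x|) g]).
Proof.
split=> [[G [G_orlicz G_superlinear GK]]|[g [g1 _ Kg]]].
  apply: submajorized_of_excess_small => // e.
  exact: orlicz_excess_small GK.
exact: orlicz_of_submajorized Kg.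
Qed.
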